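(* Let $\mathcal{C}$ be either the category $\mathsf{LCAb}$ or the category $\mathsf{TAb}$, and let $$\begin{array}{ccc} A & \stackrel{\alpha}{\longrightarrow} & A' \\ {\scriptstyle f}\downarrow & & \downarrow{\scriptstyle f'} \\ B & \stackrel{\beta}{\longrightarrow} & B' \end{array}$$ be a commutative diagram in $\mathcal{C}$. (i) If it is a pushout square in $\mathcal{C}$ and $f$ is a strict monomorphism, then $f'$ is also a strict monomorphism. (ii) If it is a pullback square in $\mathcal{C}$ and $f'$ is a strict epimorphism, then $f$ is also a strict epimorphism.
   Context: $\mathsf{TAb}$ is the additive category of abelian Hausdorff topological groups and continuous homomorphisms; $\mathsf{LCAb} \subseteq \mathsf{TAb}$ is the full subcategory of locally compact (Hausdorff) abelian groups. In both categories a morphism $f: A \to B$ has kernel $f^{-1}(0)$ and cokernel $B/\overline{f(A)}$; $f$ is a monomorphism if $\ker f = 0$ and an epimorphism if $\mathrm{coker} f = 0$. A morphism $f: A \to B$ is strict if the induced monomorphism $A/\ker(f) \to B$ is a closed embedding. *)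

(* Defs.v *)
From HB Require Import structures.
From mathcomp Require Import all_boot all_order all_algebra.
From mathcomp Require Import generic_quotient ring_quotient.
From mathcomp Require Import all_classical topology tvs.

Set Implicit Arguments.
Unset Strict Implicit.
Unset Printing Implicit Defensive.

Import GRing.Theory.

Local Open Scope classical_set_scope.
Local Open Scope ring_scope.
Local Open Scope quotient_scope.

#[short(type="contHomType")]
HB.structure Definition ContHom (A B : topologicalZmodType) :=
  {f of @GRing.Additive A B f & @Continuous A B f}.

Section TopologicalQuotient.
Variables (G : topologicalZmodType) (H : zmodClosed G).

Definition top_quot : Type := quotient_topology (Quotient.quot H).

HB.instance Definition _ := Topological.on top_quot.
HB.instance Definition _ := Quotient.on top_quot.
HB.instance Definition _ := GRing.isZmodule.Build top_quot
  (@Quotient.addqA G H) (@Quotient.addqC G H) (@Quotient.add0q G H)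
  (@Quotient.addNq G H).

Definition top_quot_pi : G -> top_quot := \pi_top_quot.

Lemma top_quot_piP (x y : G) :
  reflect (top_quot_pi x = top_quot_pi y) (x - y \in H).
Proof. rewrite (Quotient.idealrBE H). exact: (@eqP (Quotient.quot H)). Qed.

Lemma top_quot_pi_zmod_morphism : zmod_morphism top_quot_pi.
Proof. exact: (@pi_is_zmod_morphism G _ 0 (Quotient.quot H)). Qed.

Lemma top_quot_pi_continuous : continuous top_quot_pi.
Proof. exact: pi_continuous. Qed.

Lemma top_quot_pi_open (U : set G) : open U -> open (top_quot_pi @` U).
Proof.
move=> oU; rewrite /open/= /quotient_open.
have -> : \pi_(quotient_topology (Quotient.quot H)) @^-1` (top_quot_pi @` U) =
    \bigcup_(h in [set h | h \in H]) ((fun x => x + h) @^-1` U).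
  apply/seteqP; split => [x [u Uu /top_quot_piP uxH]|x [h Hh Uxh]].
    by exists (u - x); rewrite //= addrC subrK.
  exists (x + h) => //; apply/top_quot_piP.
  by rewrite addrAC subrr add0r.
apply: bigcup_open => h _; apply: open_comp => // x _.
apply: (@continuous_comp _ _ _ (fun x => (x, h)) (fun z : G * G => z.1 + z.2)).
  by apply: cvg_pair => /=; [exact: cvg_id|exact: cvg_cst].
exact: add_continuous.
Qed.

Lemma top_quot_sub_continuous :
  continuous (fun z : top_quot * top_quot => z.1 - z.2).
Proof.
move=> [p q]; rewrite -[p]reprK -[q]reprK.
set x := repr p; set y := repr q => U /=.
rewrite -[_ - _]/(top_quot_pi x - top_quot_pi y) -top_quot_pi_zmod_morphism.
move=> /top_quot_pi_continuous /(@sub_continuous G (x, y)) [[V W] [/= nV nW] VWU].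
exists (top_quot_pi @` V, top_quot_pi @` W).
  move: nV nW; rewrite nbhsE => -[V' oV' V'V]; rewrite nbhsE => -[W' oW' W'W].
  split; rewrite nbhsE /=.
    exists (top_quot_pi @` V'); last exact: image_subset.
    by split; [exact: top_quot_pi_open oV'.1|exists x => //; exact: oV'.2].
  exists (top_quot_pi @` W'); last exact: image_subset.
  by split; [exact: top_quot_pi_open oW'.1|exists y => //; exact: oW'.2].
move=> [_ _] [/= [v Vv <-] [w Ww <-]].
by rewrite -top_quot_pi_zmod_morphism; exact: (VWU (v, w)).
Qed.

HB.instance Definition _ :=
  PreTopologicalNmodule_isTopologicalZmodule.Build top_quot
    top_quot_sub_continuous.

HB.instance Definition _ := GRing.isZmodMorphism.Build G top_quot top_quot_pi
  top_quot_pi_zmod_morphism.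
HB.instance Definition _ := isContinuous.Build G top_quot top_quot_pi
  top_quot_pi_continuous.

End TopologicalQuotient.

Section Morphisms.
Variables (A B : topologicalZmodType) (f : contHomType A B).

Definition ker : {pred A} := [pred x | f x == 0].

Lemma ker_zmod_closed : zmod_closed ker.
Proof.
split=> [|x y /eqP fx /eqP fy]; apply/eqP; first exact: raddf0.
by rewrite [LHS]raddfB [X in X - _]fx [X in _ - X]fy subr0.
Qed.
HB.instance Definition _ := GRing.isZmodClosed.Build A ker ker_zmod_closed.

Definition im_closure : {pred B} := [pred y | y \in closure (range f)].

Lemma im_closure_zmod_closed : zmod_closed im_closure.
Proof.
split=> [|x y]; rewrite !inE.
  by apply: subset_closure; exists 0 => //; rewrite raddf0.
move=> cx cy U /(@sub_continuous B (x, y)) [[V W] [/= nV nW] VWU].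
have [_ [[a _ <-] Va]] := cx _ nV.
have [_ [[b _ <-] Wb]] := cy _ nW.
by exists (f (a - b)); split; [exists (a - b)|rewrite raddfB; exact: (VWU (_, _))].
Qed.
HB.instance Definition _ :=
  GRing.isZmodClosed.Build B im_closure im_closure_zmod_closed.

Definition coker : topologicalZmodType := top_quot im_closure.

Definition coim : topologicalZmodType := top_quot ker.

(* The map A / ker f -> B induced by f; see coim_map_pi. *)
Definition coim_map (x : coim) : B := f (repr (x : top_quot ker)).

Lemma coim_map_pi (x : A) : coim_map (top_quot_pi ker x) = f x.
Proof.
apply/eqP; rewrite -subr_eq0 -raddfB.
by apply/(@top_quot_piP A ker); exact: reprK.
Qed.

Definition monomorphism : Prop := ker =i pred1 0.

Definition epimorphism : Prop := forall y : coker, y = 0.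

End Morphisms.

Definition closed_embedding (X Y : topologicalType) (f : X -> Y) : Prop :=
  [/\ injective f,
      forall U : set X, open U <-> exists2 V : set Y, open V & f @^-1` V = U
    & closed (range f)].

Definition strict (A B : topologicalZmodType) (f : contHomType A B) : Prop :=
  closed_embedding (@coim_map A B f).

Definition strict_mono (A B : topologicalZmodType) (f : contHomType A B) :=
  strict f /\ monomorphism f.

Definition strict_epi (A B : topologicalZmodType) (f : contHomType A B) :=
  strict f /\ epimorphism f.

Variant category := TAb | LCAb.

Definition in_category (C : category) (A : topologicalZmodType) : Prop :=
  match C with
  | TAb => hausdorff_space A
  | LCAb => hausdorff_space A /\ locally_compact [set: A]
  end.

(* The morphisms of C are all the continuous homomorphisms between objects of C,
   since LCAb is full in TAb. Equality of morphisms is pointwise equality. *)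
Record object (C : category) := Object {
  carrier :> topologicalZmodType;
  objectP : in_category C carrier
}.

Section Squares.
Variables (C : category) (A A' B B' : object C).
Variables (alpha : contHomType A A') (f : contHomType A B).
Variables (f' : contHomType A' B') (beta : contHomType B B').

Definition commutative_square : Prop := f' \o alpha =1 beta \o f.

Definition pushout_square : Prop :=
  commutative_square /\
  forall (T : object C) (g : contHomType B T) (h : contHomType A' T),
    g \o f =1 h \o alpha ->
    exists2 u : contHomType B' T, u \o beta =1 g /\ u \o f' =1 h
      & forall v : contHomType B' T,
          v \o beta =1 g -> v \o f' =1 h -> v =1 u.

Definition pullback_square : Prop :=
  commutative_square /\
  forall (T : object C) (g : contHomType T B) (h : contHomType T A'),
    beta \o g =1 f' \o h ->
    exists2 u : contHomType T A, f \o u =1 g /\ alpha \o u =1 h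
      & forall v : contHomType T A,
          f \o v =1 g -> alpha \o v =1 h -> v =1 u.

End Squares.

(* Main.v *)
Require Import Defs.
From HB Require Import structures.
From mathcomp Require Import all_boot all_order all_algebra.
From mathcomp Require Import all_classical topology tvs.

(** Both parts compare the given square with an explicit model of the pushout
or pullback, built inside the category at hand, for which the conclusion is
read off the construction; the universal property then transfers it to the
given square.

A strict monomorphism is the same thing as a closed embedding, and a strict
epimorphism the same thing as an open surjection ([strict_monoP],
[strict_epiP]); for the latter, the image of a strict morphism is closed, so
being an epimorphism forces it to be everything.

For the pushout, let N be the image of a |-> (alpha a, f a) in A' + B. Because
f is a closed embedding and A' is Hausdorff, N is closed: it is the graph of
the continuous map alpha o f^-1, defined on the closed subgroup f(A)
([glue_closed]). Hence (A' + B) / N is Hausdorff, and locally compact when A'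
and B are, so it is a legitimate test object. The map x |-> [(x, 0)] from A' to
it is a closed embedding ([pushout_inl_closed_embedding]): its range has the
closed preimage A' + f(A) in A' + B, and another representative (x - alpha a, -
f a) of [(x, 0)] has a small second coordinate only if a is small, f being an
embedding, so that its first coordinate stays close to x. The universal
property of B' gives u from B' to the quotient and its uniqueness clause makes
u injective; as u o f' is a closed embedding, f' is one.

For the pullback, the fibre product of B and A' over B' is the kernel of (y, x)
|-> beta y - f' x, a closed subgroup of B + A' and hence an object of the
category. Its projection to B is onto and open because f' is, the image of the
part of a box V x O lying in it being V intersected with beta^-1(f'(O))
([pullback_fst_open]). The universal property of A writes this projection as f
o u, where u, from the fibre product to A, satisfies u o w = id for w = (f,
alpha); so f is onto and f(U) is the projection of u^-1(U). *)

Set Implicit Arguments.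
Unset Strict Implicit.
Unset Printing Implicit Defensive.

Import GRing.Theory.

Local Open Scope classical_set_scope.
Local Open Scope ring_scope.

(** * Continuous homomorphisms *)

Definition cont_hom (A B : topologicalZmodType) (f : A -> B)
    (fB : zmod_morphism f) (fc : continuous f) : contHomType A B :=
  HB.pack f (GRing.isZmodMorphism.Build A B f fB) (isContinuous.Build A B f fc).

Section HomConstructions.
Variables A B C : topologicalZmodType.

Lemma id_zmod_morphism : zmod_morphism (@idfun A).
Proof. by []. Qed.

Lemma id_continuous : continuous (@idfun A).
Proof. by move=> x; exact: cvg_id. Qed.

Lemma null_zmod_morphism : zmod_morphism (fun _ : A => 0 : B).
Proof. by move=> x y; rewrite subrr. Qed.

Lemma null_continuous : continuous (fun _ : A => 0 : B).
Proof. by move=> x; exact: cvg_cst. Qed.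

Definition null_hom := cont_hom null_zmod_morphism null_continuous.

Lemma opp_zmod_morphism : zmod_morphism (-%R : A -> A).
Proof. by move=> x y; rewrite opprD. Qed.

Definition opp_hom := cont_hom opp_zmod_morphism (@opp_continuous A).

Definition id_hom := cont_hom id_zmod_morphism id_continuous.

Variables (f : contHomType A B) (g : contHomType B C).

Lemma comp_zmod_morphism : zmod_morphism (g \o f).
Proof. by move=> x y; rewrite /= !raddfB. Qed.

Lemma comp_continuous : continuous (g \o f).
Proof. by move=> x; apply: continuous_comp; exact: cts_fun. Qed.

Definition comp_hom := cont_hom comp_zmod_morphism comp_continuous.

End HomConstructions.

Lemma nbhs_open (T : topologicalType) (x : T) (U : set T) :
  nbhs x U -> exists2 V : set T, open V /\ V x & V `<=` U.
Proof. by rewrite nbhsE => -[V]; exists V. Qed.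

Lemma nbhs_setX (S T : topologicalType) (x : S) (y : T) (U : set S)
    (V : set T) :
  nbhs x U -> nbhs y V -> nbhs (x, y) (U `*` V).
Proof. by move=> xU yV; exists (U, V). Qed.

(** * Biproducts of topological groups *)

(** The product type is renamed so that its topological group structure does not
compete with the one that products of topological vector spaces carry. *)
Definition biprod (A B : topologicalZmodType) : Type := (A * B)%type.

HB.instance Definition _ (A B : topologicalZmodType) :=
  Topological.on (biprod A B).
HB.instance Definition _ (A B : topologicalZmodType) :=
  GRing.Zmodule.on (biprod A B).

Lemma biprod_sub_continuous (A B : topologicalZmodType) :
  continuous (fun z : biprod A B * biprod A B => z.1 - z.2).
Proof.
move=> [[a b] [a' b']] U [[V W] /= [aV bW] VWU].
have [[V1 V2] /= [aV1 aV2] V12] := @sub_continuous A (a, a') _ aV.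
have [[W1 W2] /= [bW1 bW2] W12] := @sub_continuous B (b, b') _ bW.
exists (V1 `*` W1, V2 `*` W2); first by split; apply: nbhs_setX.
move=> [[x y] [x' y']] /= [[V1x W1y] [V2x W2y]]; apply: VWU; split.
  exact: (V12 (x, x')).
exact: (W12 (y, y')).
Qed.

HB.instance Definition _ (A B : topologicalZmodType) :=
  PreTopologicalNmodule_isTopologicalZmodule.Build (biprod A B)
    (@biprod_sub_continuous A B).

Section BiproductHoms.
Variables A B C : topologicalZmodType.

Lemma fst_zmod_morphism : zmod_morphism (fst : biprod A B -> A).
Proof. by []. Qed.

Lemma fst_continuous : continuous (fst : biprod A B -> A).
Proof. by move=> z; exact: cvg_fst. Qed.

Definition fst_hom := cont_hom fst_zmod_morphism fst_continuous.

Lemma snd_zmod_morphism : zmod_morphism (snd : biprod A B -> B).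
Proof. by []. Qed.

Lemma snd_continuous : continuous (snd : biprod A B -> B).
Proof. by move=> z; exact: cvg_snd. Qed.

Definition snd_hom := cont_hom snd_zmod_morphism snd_continuous.

Section Pair.
Variables (f : contHomType C A) (g : contHomType C B).

Definition pair_fun (x : C) : biprod A B := (f x, g x).

Lemma pair_zmod_morphism : zmod_morphism pair_fun.
Proof. by move=> x y; rewrite /pair_fun !raddfB. Qed.

Lemma pair_continuous : continuous pair_fun.
Proof. by move=> x; apply: cvg_pair => /=; exact: cts_fun. Qed.

Definition pair_hom := cont_hom pair_zmod_morphism pair_continuous.

End Pair.

Section Difference.
Variables (f : contHomType A C) (g : contHomType B C).

Definition diff_fun (z : biprod A B) : C := f z.1 - g z.2.

Lemma diff_zmod_morphism : zmod_morphism diff_fun.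
Proof.
move=> x y; rewrite /diff_fun /=.
by rewrite [f _]raddfB [g _]raddfB !opprD !opprK addrACA.
Qed.

Lemma diff_continuous : continuous diff_fun.
Proof.
move=> z; apply: (@continuous_comp _ _ _ (fun z : biprod A B => (f z.1, g z.2))
  (fun x : C * C => x.1 - x.2)); last exact: sub_continuous.
apply: cvg_pair => /=.
  by apply: continuous_comp; [exact: cvg_fst|exact: cts_fun].
by apply: continuous_comp; [exact: cvg_snd|exact: cts_fun].
Qed.

Definition diff_hom := cont_hom diff_zmod_morphism diff_continuous.

End Difference.
End BiproductHoms.

(** * Quotients and subgroups *)

Lemma top_quot_pi_surj (G : topologicalZmodType) (H : zmodClosed G)
    (p : top_quot H) : exists x, top_quot_pi H x = p.
Proof. by exists (repr p); exact: reprK. Qed.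

Section Lift.
Variables (G B : topologicalZmodType) (H : zmodClosed G) (h : contHomType G B).
Hypothesis hH : forall x, x \in H -> h x = 0.

Definition lift_fun (p : top_quot H) : B := h (repr p).

Lemma lift_funE x : lift_fun (top_quot_pi H x) = h x.
Proof.
apply/eqP; rewrite -subr_eq0 -raddfB; apply/eqP/hH.
by apply/(@top_quot_piP G H); exact: reprK.
Qed.

Lemma lift_zmod_morphism : zmod_morphism lift_fun.
Proof.
move=> p q; have [x <-] := top_quot_pi_surj p.
have [y <-] := top_quot_pi_surj q.
rewrite -top_quot_pi_zmod_morphism !lift_funE.
exact: raddfB.
Qed.

Lemma lift_continuous : continuous lift_fun.
Proof.
apply/quotient_continuous.
rewrite (_ : _ \o _ = h); first exact: cts_fun.
by apply/funext => x; exact: lift_funE.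
Qed.

Definition lift_hom := cont_hom lift_zmod_morphism lift_continuous.

End Lift.

Lemma top_quot_closed (G : topologicalZmodType) (H : zmodClosed G)
    (F : set (top_quot H)) :
  closed (top_quot_pi H @^-1` F) -> closed F.
Proof.
by rewrite -!openC preimage_setC.
Qed.

Section Subgroup.
Variables (G : topologicalZmodType) (H : zmodClosed G).

Record subgroup :=
  Subgroup { subgroup_val : G; subgroup_valP : subgroup_val \in H }.

HB.instance Definition _ := [isSub for subgroup_val].
HB.instance Definition _ := [Choice of subgroup by <:].
HB.instance Definition _ := [SubChoice_isSubZmodule of subgroup by <:].
HB.instance Definition _ :=
  Topological.copy subgroup (initial_topology subgroup_val).

Lemma subgroup_val_continuous : continuous subgroup_val.
Proof. exact: initial_continuous. Qed.

Lemma subgroup_sub_continuous :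
  continuous (fun z : subgroup * subgroup => z.1 - z.2).
Proof.
apply: continuous_comp_initial => z.
apply: (@continuous_comp _ _ _
  (fun z : subgroup * subgroup => (subgroup_val z.1, subgroup_val z.2))
  (fun z : G * G => z.1 - z.2)); last exact: sub_continuous.
apply: cvg_pair => /=.
  apply: (@continuous_comp _ _ _ fst subgroup_val); first exact: cvg_fst.
  exact: subgroup_val_continuous.
apply: (@continuous_comp _ _ _ snd subgroup_val); first exact: cvg_snd.
exact: subgroup_val_continuous.
Qed.

HB.instance Definition _ :=
  PreTopologicalNmodule_isTopologicalZmodule.Build subgroup
    subgroup_sub_continuous.

Lemma subgroup_val_zmod_morphism : zmod_morphism subgroup_val.
Proof. by []. Qed.

Definition subgroup_incl :=
  cont_hom subgroup_val_zmod_morphism subgroup_val_continuous.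

Section Corestriction.
Variables (A : topologicalZmodType) (f : contHomType A G).
Hypothesis fH : forall x, f x \in H.

Definition corestr_fun (x : A) : subgroup := Subgroup (fH x).

Lemma corestr_zmod_morphism : zmod_morphism corestr_fun.
Proof. by move=> x y; apply/val_inj; rewrite /= raddfB. Qed.

Lemma corestr_continuous : continuous corestr_fun.
Proof. apply: continuous_comp_initial => x; exact: (@cts_fun _ _ f). Qed.

Definition corestr_hom := cont_hom corestr_zmod_morphism corestr_continuous.

End Corestriction.
End Subgroup.

(** * Stability of the two categories under the constructions *)

(** Every neighbourhood of [p - q] contains a difference [V - W] of
neighbourhoods of [p] and [q]; if these always meet, [p - q] is a limit of [0].
*)
Lemma closed0_hausdorff (G : topologicalZmodType) :
  closed [set 0 : G] -> hausdorff_space G.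
Proof.
move=> c0 p q pq; apply/eqP; rewrite -subr_eq0; apply/eqP.
apply: c0 => U /(@sub_continuous G (p, q)) [[V W] /= [pV qW] VWU].
have [x [Vx Wx]] := pq _ _ pV qW.
by exists 0; split=> //; rewrite -(subrr x); apply: (VWU (x, x)).
Qed.

Lemma hausdorff_closed0 (G : topologicalZmodType) :
  hausdorff_space G -> closed [set 0 : G].
Proof. by move=> /hausdorff_accessible /accessible_closed_set1. Qed.

(** In a Hausdorff space compact neighbourhoods are automatically closed. *)
Lemma hausdorff_locally_compactP (T : topologicalType) : hausdorff_space T ->
  locally_compact [set: T] <->
  forall x : T, exists2 K, nbhs x K & compact K.
Proof.
move=> hT; split=> [lT x|lT x _]; rewrite ?withinT.
  have [K + [cK _]] := lT x I.
  by rewrite withinET => xK; exists K.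
have [K xK cK] := lT x; exists K; first by rewrite withinET.
by split=> //; exact: compact_closed.
Qed.

Lemma in_category_hausdorff C (G : topologicalZmodType) :
  in_category C G -> hausdorff_space G.
Proof. by case: C => // -[]. Qed.

(** Treats both categories at once: an object built from [G1] and [G2] is in the
category as soon as it is Hausdorff and the construction preserves the
existence of compact neighbourhoods. *)
Lemma in_category_transfer C (G G1 G2 : topologicalZmodType) :
    in_category C G1 -> in_category C G2 ->
    hausdorff_space G ->
    ((forall x : G1, exists2 K, nbhs x K & compact K) ->
     (forall x : G2, exists2 K, nbhs x K & compact K) ->
     (forall x : G, exists2 K, nbhs x K & compact K)) ->
  in_category C G.
Proof.
case: C => // -[h1 l1] [h2 l2] hG lG; split=> //.
apply/hausdorff_locally_compactP => //.
by apply: lG; apply/hausdorff_locally_compactP.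
Qed.

Lemma biprod_in_category C (A B : topologicalZmodType) :
  in_category C A -> in_category C B -> in_category C (biprod A B).
Proof.
move=> cA cB; apply: (in_category_transfer cA cB) => [|lA lB [a b]].
  apply: closed0_hausdorff.
  rewrite [X in closed X](_ : _ =
      (fst @^-1` [set 0 : A]) `&` (snd @^-1` [set 0 : B])).
    apply: closedI; apply: (continuous_closedP _).1.
    - by move=> ?; exact: cvg_fst.
    - exact/hausdorff_closed0/(in_category_hausdorff cA).
    - by move=> ?; exact: cvg_snd.
    - exact/hausdorff_closed0/(in_category_hausdorff cB).
  by apply/seteqP; split=> [[x y] [-> ->]|[x y] [/= -> ->]].
have [K aK cK] := lA a; have [L bL cL] := lB b.
by exists (K `*` L); [exact: nbhs_setX|exact: compact_setX].
Qed.

(** The origin of the quotient is closed because its preimage is [H]; images of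
compact neighbourhoods are compact neighbourhoods since the projection is both
continuous and open. *)
Lemma top_quot_in_category C (G : topologicalZmodType) (H : zmodClosed G) :
  in_category C G -> closed [set x | x \in H] -> in_category C (top_quot H).
Proof.
move=> cG clH; apply: (in_category_transfer cG cG) => [|lG _ p].
  apply: closed0_hausdorff; apply: (@top_quot_closed G H [set 0]).
  rewrite [X in closed X](_ : _ = [set x | x \in H])//.
  apply/seteqP; split=> [x xH|x xH] /=.
    by rewrite -(subr0 x); apply/(@top_quot_piP G H); rewrite raddf0.
  rewrite -(raddf0 (top_quot_pi H)).
  by apply/(@top_quot_piP G H); rewrite subr0.
have [K /nbhs_open[V [oV Vp] VK] cK] := lG (repr p).
exists (top_quot_pi H @` K).
  rewrite nbhsE; exists (top_quot_pi H @` V); last exact: image_subset.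
  by split; [exact: top_quot_pi_open|exists (repr p) => //; exact: reprK].
apply: continuous_compact => //.
by apply: continuous_subspaceT => x; exact: top_quot_pi_continuous.
Qed.

(** A filter on the subgroup is pushed to [G]; its image clusters at a point of
[K] which lies in [H] because [H] is closed, and this point is a cluster point
of the original filter for the induced topology. *)
Lemma subgroup_preimage_compact (G : topologicalZmodType) (H : zmodClosed G)
    (K : set G) :
  closed [set x | x \in H] -> compact K ->
  compact (@subgroup_val G H @^-1` K).
Proof.
move=> clH cK F FF FK.
have FKH : F (@subgroup_val G H @^-1` (K `&` [set x | x \in H])).
  by apply: filterS FK => y Ky; split; [exact: Ky|exact: (subgroup_valP y)].
have [x [[Kx Hx] clx]] :=
  compact_closedI cK clH (fmap_proper_filter (@subgroup_val G H) FF) FKH.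
exists (Subgroup Hx); split=> // A B FA [_ [[O oO <-] Ox] OB].
have FvA : F (@subgroup_val G H @^-1` (@subgroup_val G H @` A)).
  by apply: filterS FA => a Aa; exists a.
have [_ [[a Aa <-] Oa]] := clx _ _ FvA (open_nbhs_nbhs (conj oO Ox)).
by exists a; split=> //; exact: OB.
Qed.

Lemma subgroup_in_category C (G : topologicalZmodType) (H : zmodClosed G) :
  in_category C G -> closed [set x | x \in H] -> in_category C (subgroup H).
Proof.
move=> cG clH; apply: (in_category_transfer cG cG) => [|lG _ x].
  apply: closed0_hausdorff.
  rewrite [X in closed X](_ : _ = @subgroup_val G H @^-1` [set 0]).
    apply: (continuous_closedP _).1; first exact: subgroup_val_continuous.
    exact/hausdorff_closed0/(in_category_hausdorff cG).
  by apply/seteqP; split=> [y -> //|y y0]; apply/val_inj.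
have [K xK cK] := lG (subgroup_val x).
exists (@subgroup_val G H @^-1` K); last exact: subgroup_preimage_compact.
exact: subgroup_val_continuous.
Qed.

(** * Strict monomorphisms and strict epimorphisms *)

Section StrictMorphisms.
Variables (A B : topologicalZmodType) (f : contHomType A B).
Local Notation coim_f := (@coim_map A B f).

Lemma monomorphismP : monomorphism f <-> injective f.
Proof.
split=> [f0 x y fxy|fI x].
  apply/eqP; rewrite -subr_eq0; have := f0 (x - y).
  by rewrite !inE raddfB [X in X - _]fxy subrr eqxx => <-.
by rewrite !inE -(inj_eq fI) raddf0.
Qed.

Lemma range_coim_map : range coim_f = range f.
Proof.
apply/seteqP; split=> [_ [x _ <-]|_ [x _ <-]]; first by exists (repr x).
by exists (top_quot_pi (ker f) x) => //; exact: coim_map_pi.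
Qed.

Lemma coim_map_inj : injective coim_f.
Proof.
move=> p q; have [x <-] := top_quot_pi_surj p.
have [y <-] := top_quot_pi_surj q.
rewrite !coim_map_pi => fpq; apply/(@top_quot_piP A (ker f)).
by rewrite inE raddfB [X in X - _]fpq subrr.
Qed.

Lemma coim_map_continuous : continuous coim_f.
Proof.
apply/quotient_continuous; rewrite (_ : _ \o _ = f); first exact: cts_fun.
by apply/funext => x; exact: coim_map_pi.
Qed.

(** When [f] is injective the projection of [A] to its coimage is an open
continuous bijection, so [f] and its coimage map induce the same topology and
have the same range. *)
Lemma strict_monoP : strict_mono f <-> closed_embedding f.
Proof.
split=> [[[_ fo fcl] /monomorphismP fI]|[fI fo fcl]].
  split=> //; last by rewrite -range_coim_map.
  move=> U; split=> [oU|[V oV <-]]; last first.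
    exact: (continuousP _).1 (@cts_fun _ _ f) _ oV.
  have [V oV /seteqP VU] := (fo _).1 (@top_quot_pi_open A (ker f) _ oU).
  have {}VU x : V (f x) <-> (top_quot_pi (ker f) @` U) (top_quot_pi (ker f) x).
    by rewrite -coim_map_pi; split; [exact: VU.1|exact: VU.2].
  exists V => //; apply/seteqP; split=> x; rewrite /= VU; last by exists x.
  by move=> [y Uy] /(congr1 coim_f); rewrite !coim_map_pi => /fI <-.
split; last exact/monomorphismP.
split; [exact: coim_map_inj| |by rewrite range_coim_map].
move=> U; split=> [oU|[V oV <-]].
  have [V oV VU] := (fo _).1 oU.
  exists V => //; apply/seteqP; split=> p; have [x <-] := top_quot_pi_surj p.
    by rewrite /= coim_map_pi; have /seteqP[VU1 _] := VU; exact: VU1.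
  by rewrite /= coim_map_pi; have /seteqP[_ VU2] := VU; exact: VU2.
exact: (continuousP _).1 coim_map_continuous _ oV.
Qed.

(** Surjectivity comes from combining the closed range (strictness) with the
dense range (epimorphism); openness then says that the coimage map, which is
always a continuous bijection onto the range, is a homeomorphism. *)
Lemma strict_epiP : strict_epi f <->
  (forall y, exists x, f x = y) /\ (forall U, open U -> open (f @` U)).
Proof.
split=> [[[_ fo fcl] fepi]|[fsurj fop]].
  have fsurj y : exists x, f x = y.
    have : range f y.
      move: fcl; rewrite range_coim_map => /closure_id ->.
      have /(@top_quot_piP B (im_closure f)) :
        top_quot_pi (im_closure f) y = top_quot_pi (im_closure f) 0.
        by rewrite raddf0; exact: fepi.
      by rewrite subr0 !inE.
    by case=> x _ <-; exists x.
  split=> // U oU.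
  have [V oV /seteqP VU] := (fo _).1 (@top_quot_pi_open A (ker f) _ oU).
  have {}VU x : V (f x) <-> (top_quot_pi (ker f) @` U) (top_quot_pi (ker f) x).
    by rewrite -coim_map_pi; split; [exact: VU.1|exact: VU.2].
  rewrite (_ : f @` U = V) //; apply/seteqP; split=> [_ [x Ux <-]|y Vy].
    by apply/VU; exists x.
  have [x xy] := fsurj y; rewrite -xy in Vy *.
  have /VU[z Uz /(congr1 coim_f)] := Vy.
  by rewrite !coim_map_pi => fzx; exists z.
split; last first.
  move=> p; have [y <-] := top_quot_pi_surj p.
  rewrite -(raddf0 (top_quot_pi (im_closure f))).
  apply/(@top_quot_piP B (im_closure f)); rewrite subr0 !inE.
  by have [x <-] := fsurj y; apply: subset_closure; exists x.
split; first exact: coim_map_inj.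
  move=> U; split=> [oU|[V oV <-]]; last first.
    exact: (continuousP _).1 coim_map_continuous _ oV.
  exists (coim_f @` U).
    rewrite (_ : _ @` U = f @` (top_quot_pi (ker f) @^-1` U)).
      by apply: fop.
    apply/seteqP; split=> [_ [p Up <-]|_ [x Ux <-]].
      have [x xp] := top_quot_pi_surj p; rewrite -xp in Up *.
      by exists x => //; rewrite coim_map_pi.
    by exists (top_quot_pi (ker f) x) => //; rewrite coim_map_pi.
  apply/seteqP; split=> [p [q Uq /coim_map_inj <-] //|p Up].
  by exists p.
rewrite range_coim_map (_ : range f = setT); first exact: closedT.
by apply/seteqP; split=> // y _; have [x <-] := fsurj y; exists x.
Qed.

End StrictMorphisms.

(** Injectivity of [u] makes the range of [f] the preimage of the range of
[u \o f]. *)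
Lemma closed_embedding_comp_cancel (X Y Z : topologicalType)
    (f : X -> Y) (u : Y -> Z) :
  continuous f -> continuous u -> injective u ->
  closed_embedding (u \o f) -> closed_embedding f.
Proof.
move=> fc uc uI [ufI ufo ufcl]; split.
- by move=> x y fxy; apply: ufI; rewrite /= fxy.
- move=> U; split=> [/ufo[V oV <-]|[V oV <-]].
    by exists (u @^-1` V); first exact: (continuousP _).1 uc _ oV.
  exact: (continuousP _).1 fc _ oV.
rewrite (_ : range f = u @^-1` range (u \o f)).
  exact: (continuous_closedP _).1 uc _ ufcl.
apply/seteqP; split=> [_ [x _ <-]|y [x _ /uI <-]]; by exists x.
Qed.

Lemma preimage_openP (X Y : topologicalType) (f : X -> Y) (U : set X) :
  (forall x, U x ->
    exists V : set Y, [/\ open V, V (f x) & f @^-1` V `<=` U]) ->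
  exists2 V, open V & f @^-1` V = U.
Proof.
move=> fU; exists (\bigcup_(V in [set V | open V /\ f @^-1` V `<=` U]) V).
  by apply: bigcup_open => V [].
apply/seteqP; split=> [x [V [_ VU] Vx]|x /fU[V [oV Vx VU]]]; first exact: VU.
by exists V.
Qed.

(** * A model of the pushout *)

Section Pushout.
Variables A A' B : topologicalZmodType.
Variables (alpha : contHomType A A') (f : contHomType A B).

(** Gluing along the graph [(alpha a, f a)] rather than [(alpha a, - f a)] moves
the sign into the map from [B] to the quotient, so that the square still
commutes. *)
Definition glue : {pred biprod A' B} :=
  [pred z | z \in range (pair_hom alpha f)].

Lemma glueP z : z \in glue <-> exists a, z = (alpha a, f a).
Proof.
by rewrite !inE; split=> [[a _ <-]|[a ->]]; exists a.
Qed.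

Lemma glue_zmod_closed : zmod_closed glue.
Proof.
split=> [|_ _ /glueP[a ->] /glueP[b ->]]; apply/glueP.
  by exists 0; rewrite !raddf0.
by exists (a - b); rewrite !raddfB.
Qed.
HB.instance Definition _ :=
  GRing.isZmodClosed.Build (biprod A' B) glue glue_zmod_closed.

Definition pushout : topologicalZmodType := top_quot glue.

Definition pushout_inl : contHomType A' pushout :=
  comp_hom (pair_hom (id_hom A') (null_hom A' B)) (top_quot_pi glue).

Definition pushout_inr : contHomType B pushout :=
  comp_hom (pair_hom (null_hom B A') (opp_hom B)) (top_quot_pi glue).

Lemma pushout_comm : pushout_inr \o f =1 pushout_inl \o alpha.
Proof.
move=> a; apply/esym/(@top_quot_piP _ glue)/glueP; exists a.
by rewrite /= /pair_fun /=; congr (_, _); rewrite ?subr0 ?sub0r ?opprK.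
Qed.

Hypothesis f_emb : closed_embedding f.

(** A limit [(x, y)] of points [(alpha b, f b)] has [y = f a], the range of [f]
being closed.  If [f b] is close to [f a] then [b] is close to [a], so [alpha b]
is close both to [x] and to [alpha a], which must then agree. *)
Lemma glue_closed : hausdorff_space A' -> closed [set z | z \in glue].
Proof.
have [fI fo fcl] := f_emb.
move=> /hausdorff_closed0 cl0 [x y] xy.
have [a _ fa] : range f y.
  apply: fcl => V yV.
  have [[_ _] [/glueP[a [-> ->]] [_ Va]]] := xy _ (nbhs_setX filterT yV).
  by exists (f a); split=> //; exists a.
apply/glueP; exists a; rewrite -fa; congr (_, _).
apply/eqP; rewrite -subr_eq0; apply/eqP/cl0.
move=> U /(@sub_continuous A' (x, alpha a)) [[V W] /= [xV aW] VWU].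
have /nbhs_open[O [/fo[O' oO' <-] /= Oa] OW] := @cts_fun _ _ alpha a _ aW.
have yO' : nbhs y O' by rewrite -fa; exact: open_nbhs_nbhs.
have [[_ _] [/glueP[b [-> ->]] [/= Vb O'b]]] := xy _ (nbhs_setX xV yO').
exists 0; split=> //; rewrite -(subrr (alpha b)).
by apply: (VWU (_, _)); split=> //; exact: OW.
Qed.

Lemma pushout_in_category C : in_category C A' -> in_category C B ->
  in_category C pushout.
Proof.
move=> cA' cB; apply: top_quot_in_category; first exact: biprod_in_category.
exact/glue_closed/(in_category_hausdorff cA').
Qed.

(** For the induced topology, given [x] in the open set [U], the point is to
find a neighbourhood of the class of [(x, 0)] meeting the range only inside the
image of [U]: if [(x', 0)] and [(u, o)] have the same class, then [u - x' =
alpha a] and [o = f a], so [o] small makes [a], hence [u - x'], small. *)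
Lemma pushout_inl_closed_embedding : closed_embedding pushout_inl.
Proof.
have [fI fo fcl] := f_emb; split.
- move=> x x' /(@top_quot_piP _ glue)/glueP[a []] xa /esym.
  rewrite subrr => fa0; apply/eqP; rewrite -subr_eq0 [X in X == _]xa.
  by rewrite (fI a 0) ?raddf0.
- move=> U; split=> [oU|[V oV <-]]; last first.
    exact: (continuousP _).1 (@cts_fun _ _ pushout_inl) _ oV.
  apply: preimage_openP => x Ux.
  have : nbhs (x - 0) U by rewrite subr0; exact: open_nbhs_nbhs.
  move=> /(@sub_continuous A' (x, 0)) [[V W] /= [xV W0] VWU].
  have /nbhs_open[V' [oV' V'x] V'V] := xV.
  have a0W : nbhs (0 : A) (alpha @^-1` W).
    have aW : nbhs (alpha 0) W by rewrite raddf0.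
    exact: (@cts_fun _ _ alpha _ _ aW).
  have /nbhs_open[O [/fo[O' oO' <-] /= O0] OW] := a0W.
  exists (top_quot_pi glue @` (V' `*` O')); split.
  + apply: top_quot_pi_open; rewrite openE => -[u o] [V'u O'o].
    by apply: nbhs_setX; exact: open_nbhs_nbhs.
  + by exists (x, 0) => //; split=> //=; rewrite -(raddf0 f).
  move=> x' [[u o] [/= V'u O'o]] /(@top_quot_piP _ glue)/glueP[a []] ua.
  rewrite subr0 => oa.
  rewrite -(subKr u x') [X in _ - X]ua; apply: (VWU (_, _)); split=> /=.
    exact: V'V.
  by apply: OW; rewrite /= -oa.
apply: (@top_quot_closed _ glue).
rewrite (_ : _ @^-1` _ = snd @^-1` range f).
  by apply: (continuous_closedP _).1 fcl => ?; exact: cvg_snd.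
apply/seteqP; split=> [[x y] [x' _ /(@top_quot_piP _ glue)/glueP[a []]] _|].
  rewrite sub0r => ya; exists (- a) => //.
  by rewrite raddfN -[RHS]opprK; congr (- _).
move=> [x y] [a _ /= fa]; exists (x - alpha a) => //.
apply/esym/(@top_quot_piP _ glue)/glueP; exists a.
by rewrite fa /= /pair_fun /=; congr (_, _); rewrite ?subr0 ?subKr.
Qed.

End Pushout.

(** The map [v] induced by [f'] and [beta] goes from the model back to [B'].
Since [v \o u] and the identity agree after [f'] and [beta], the uniqueness
clause identifies them, and the comparison map [u] is injective. *)
Lemma pushout_strict_mono C (A A' B B' : object C)
    (alpha : contHomType A A') (f : contHomType A B)
    (f' : contHomType A' B') (beta : contHomType B B') :
  pushout_square alpha f f' beta -> strict_mono f -> strict_mono f'.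
Proof.
move=> [comm univ] /strict_monoP f_emb; apply/strict_monoP.
pose P := Object (pushout_in_category alpha f_emb (objectP A') (objectP B)).
have [u [ub uf] _] :=
  univ P (pushout_inr alpha f) (pushout_inl alpha f) (pushout_comm alpha f).
have gl0 z : z \in glue alpha f -> diff_hom f' beta z = 0.
  by move=> /glueP[a ->]; apply/eqP; rewrite subr_eq0; apply/eqP; exact: comm.
pose v := lift_hom gl0.
have vl x : v (pushout_inl alpha f x) = f' x.
  rewrite [LHS](lift_funE gl0) -[RHS]subr0; congr (_ - _); exact: raddf0.
have vr y : v (pushout_inr alpha f y) = beta y.
  rewrite [LHS](lift_funE gl0) /= /diff_fun /=.
  by rewrite [f' _]raddf0 [beta _]raddfN sub0r opprK.
have vuK : cancel u v.
  have [w _ wuniq] := univ B' beta f' (fun a => esym (comm a)).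
  move=> b; rewrite -[v (u b)]/(comp_hom u v b) -[RHS]/(id_hom B' b).
  rewrite (wuniq (comp_hom u v)) ?(wuniq (id_hom B')) // => x /=.
    by rewrite -[RHS]vr; exact: (congr1 v (ub x)).
  by rewrite -[RHS]vl; exact: (congr1 v (uf x)).
apply: (@closed_embedding_comp_cancel _ _ _ f' u); do ?exact: cts_fun.
  exact: can_inj vuK.
rewrite (_ : u \o f' = pushout_inl alpha f); last by apply/funext.
exact: pushout_inl_closed_embedding.
Qed.

(** * A model of the pullback *)

Section Pullback.
Variables A' B B' : topologicalZmodType.
Variables (f' : contHomType A' B') (beta : contHomType B B').

Definition pullback : topologicalZmodType := subgroup (ker (diff_hom beta f')).

Definition pullback_fst : contHomType pullback B :=
  comp_hom (subgroup_incl _) (fst_hom B A').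

Definition pullback_snd : contHomType pullback A' :=
  comp_hom (subgroup_incl _) (snd_hom B A').

Lemma pullback_comm : beta \o pullback_fst =1 f' \o pullback_snd.
Proof.
by move=> z; apply/eqP; rewrite -subr_eq0; exact: (subgroup_valP z).
Qed.

Lemma pullback_in_category C : hausdorff_space B' -> in_category C A' ->
  in_category C B -> in_category C pullback.
Proof.
move=> hB' cA' cB; apply: subgroup_in_category; first exact: biprod_in_category.
rewrite (_ : [set _ | _] = diff_hom beta f' @^-1` [set 0]).
  apply: (continuous_closedP _).1; first exact: cts_fun.
  exact: hausdorff_closed0.
by apply/seteqP; split=> z /eqP.
Qed.

Lemma pullback_fst_surj : (forall y, exists x, f' x = y) ->
  forall y, exists z, pullback_fst z = y.
Proof.
move=> f'surj y; have [x f'x] := f'surj (beta y).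
have yx : (y, x) \in ker (diff_hom beta f').
  by rewrite inE subr_eq0; apply/eqP.
by exists (Subgroup yx).
Qed.

(** The projection of the part of a box [V1 * O] lying in the pullback is the
intersection of [V1] with [beta @^-1` (f' @` O)], a neighbourhood of [y]
because [beta y = f' x] with [x] in [O]. *)
Lemma pullback_fst_open : (forall U, open U -> open (f' @` U)) ->
  forall U, open U -> open (pullback_fst @` U).
Proof.
move=> f'op _ [V oV <-]; rewrite openE => _ [z Vz <-].
case: z Vz => -[y x] yx /= Vyx.
have [[V1 V2] /= [yV1 /nbhs_open[O [oO Ox] OV2]] V12] :=
  open_nbhs_nbhs (conj oV Vyx).
have betaO : nbhs y (beta @^-1` (f' @` O)).
  apply: (@cts_fun _ _ beta); apply: open_nbhs_nbhs; split; first exact: f'op.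
  exists x => //; apply/esym/eqP; rewrite -subr_eq0; exact: yx.
apply: filterS (filterI yV1 betaO) => y' [V1y' [x' Ox' f'x']].
have yx' : (y', x') \in ker (diff_hom beta f').
  by rewrite inE subr_eq0; apply/eqP.
exists (Subgroup yx') => //=; apply: (V12 (y', x')); split=> //.
exact: OV2.
Qed.

End Pullback.

(** Since [u] is a left inverse of [w], every [f a] is the projection of [w a],
a point of the preimage of [U] under [u] when [a] is in [U]. *)
Lemma pullback_strict_epi C (A A' B B' : object C)
    (alpha : contHomType A A') (f : contHomType A B)
    (f' : contHomType A' B') (beta : contHomType B B') :
  pullback_square alpha f f' beta -> strict_epi f' -> strict_epi f.
Proof.
move=> [comm univ] /strict_epiP[f'surj f'op]; apply/strict_epiP.
have hB' := in_category_hausdorff (objectP B').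
pose P := Object (pullback_in_category f' beta hB' (objectP A') (objectP B)).
have [u [fu au] _] :=
  univ P (@pullback_fst A' B B' f' beta) (@pullback_snd A' B B' f' beta)
    (@pullback_comm A' B B' f' beta).
split=> [y|U oU].
  have [z zy] := pullback_fst_surj beta f'surj y.
  by exists (u z); rewrite -zy; exact: fu.
have wK x : pair_hom f alpha x \in ker (diff_hom beta f').
  by rewrite inE subr_eq0; apply/eqP; exact: esym (comm x).
pose w := corestr_hom wK.
have wuK : cancel w u.
  have [i _ iuniq] := univ A f alpha (fun a => esym (comm a)).
  move=> a; rewrite -[u (w a)]/(comp_hom w u a) -[RHS]/(id_hom A a).
  rewrite (iuniq (comp_hom w u)) ?(iuniq (id_hom A)) // => x /=.
    exact: fu.
  exact: au.
rewrite (_ : f @` U = @pullback_fst A' B B' f' beta @` (u @^-1` U)).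
  apply: pullback_fst_open => //.
  exact: (continuousP _).1 (@cts_fun _ _ u) _ oU.
apply/seteqP; split=> [_ [a Ua <-]|_ [z Uz <-]].
  by exists (w a); rewrite //= wuK.
by exists (u z) => //; exact: fu.
Qed.

(** * Strict morphisms in pushout and pullback squares *)

Theorem proposition1p2 (C : category) (A A' B B' : object C)
    (alpha : contHomType A A') (f : contHomType A B)
    (f' : contHomType A' B') (beta : contHomType B B')
    (square_comm : commutative_square alpha f f' beta) :
  (pushout_square alpha f f' beta -> strict_mono f -> strict_mono f') /\
  (pullback_square alpha f f' beta -> strict_epi f' -> strict_epi f).
Proof.
split; [exact: pushout_strict_mono|exact: pullback_strict_epi].
Qed.
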